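(* Let $d>1$ be an integer, $q$ a prime power with $q\equiv 1\pmod d$, and $\omega\in\mathbb{F}_q$ a primitive $d$-th root of unity. For $0\le i\le d-1$ let $$A_i(x)=x^{q^{d-1}}+\omega^i x^{q^{d-2}}+\cdots+\omega^{i(d-1)}x=\sum_{k=0}^{d-1}\omega^{ik}x^{q^{d-1-k}}.$$ Let $m_0,\dots,m_{d-1}$ be positive integers and $u_0,\dots,u_{d-1}\in\mathbb{F}_q$. Then the polynomial $$f(x)=\sum_{i=0}^{d-1}u_iA_i(x)^{m_i}$$ is a permutation polynomial of $\mathbb{F}_{q^d}$ if and only if $\{im_i:0\le i\le d-1\}$ is a complete residue system modulo $d$, $u_0\cdots u_{d-1}\in\mathbb{F}_q^\ast$, and $\gcd(m_0\cdots m_{d-1},q-1)=1$. Furthermore, if $f$ is a permutation polynomial of $\mathbb{F}_{q^d}$ and $r_0,\dots,r_{d-1}$ are positive integers with $m_ir_i\equiv 1\pmod{d(q-1)}$, then the compositional inverse of $f$ on $\mathbb{F}_{q^d}$ is $$f^{-1}(x)=\frac1d\sum_{i=0}^{d-1}\omega^i\,(du_i\omega^{-j_i})^{-r_i}A_{j_i}(x)^{r_i},$$ where for each $i$, $j_i\in\{0,\dots,d-1\}$ is the integer with $j_i\equiv im_i\pmod d$.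
   Context: A polynomial $f\in\mathbb{F}_Q[x]$ is a permutation polynomial of $\mathbb{F}_Q$ if $a\mapsto f(a)$ is a bijection of $\mathbb{F}_Q$; its compositional inverse is the (polynomial representing the) inverse map. *)

(* Defs.v *)
From HB Require Import structures.
From mathcomp Require Import all_boot all_order all_algebra.

Set Implicit Arguments.
Unset Strict Implicit.
Unset Printing Implicit Defensive.

Import GRing.Theory.
Local Open Scope ring_scope.

Definition permutation_poly (K : finFieldType) (f : {poly K}) : Prop :=
  bijective (fun a : K => f.[a]).

(* Any polynomial inducing the inverse map qualifies: [g] is not required to be
   reduced modulo ['X^#|K| - 'X]. *)
Definition compositional_inverse (K : finFieldType) (f g : {poly K}) : Prop :=
  cancel (fun a : K => f.[a]) (fun a : K => g.[a]) /\
  cancel (fun a : K => g.[a]) (fun a : K => f.[a]).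

(* [S] is read as a set, so repeated entries count once: it has exactly one
   element in each residue class. *)
Definition complete_residue_system (d : nat) (S : seq nat) : Prop :=
  forall c : nat, exists! s : nat, s \in S /\ s = c %[mod d].

Definition Apoly (F : finFieldType) (d : nat) (omega : F) (i : nat) :
    {poly F} :=
  \sum_(k < d) omega ^+ (i * k) *: 'X^(#|F| ^ (d - 1 - k)).

Definition fpoly (F : finFieldType) (d : nat) (omega : F)
    (m : 'I_d -> nat) (u : 'I_d -> F) : {poly F} :=
  \sum_(i < d) u i *: Apoly d omega i ^+ m i.

Definition finvpoly (F : finFieldType) (d : nat) (omega : F)
    (r : 'I_d -> nat) (u : 'I_d -> F) (j : 'I_d -> 'I_d) : {poly F} :=
  (d%:R)^-1 *:
    \sum_(i < d) (omega ^+ i * (d%:R * u i * omega ^- j i) ^- r i)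
                   *: Apoly d omega (j i) ^+ r i.

(* Main.v *)
(** Write [q = #|F|] and let [phi x = x ^+ q] be the Frobenius of [K], an
    [F]-linear map with [phi ^ d = id].  The map [A_i] sends [K] into the
    eigenspace [V_i] of [phi] for the eigenvalue [omega ^ i]; it kills [V_j] for
    [j <> i] modulo [d] and is multiplication by [d omega ^ -i] on [V_i].
    Since [\sum_i omega ^ i A_i x = d x], the [A_i] are coordinates on [K].
    In these coordinates [f] sends component [i] to component [i m_i mod d] by
    the power map [v |-> v ^ m_i], up to a scalar.  Hence [f] is bijective iff
    these targets are distinct, the scalars are nonzero, and each power map is
    injective on the line [V_i], where a ratio of nonzero vectors lies in the
    group of order [q - 1].  The inverse is read off coordinatewise, because
    [v ^ (d (q - 1)) = 1] for every nonzero [v] in [V_i]. *)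

Require Import Defs.
From HB Require Import structures.
From mathcomp Require Import all_boot all_order all_algebra.
From mathcomp Require Import fingroup pgroup finfield.
From mathcomp Require Import zify.

Set Implicit Arguments.
Unset Strict Implicit.
Unset Printing Implicit Defensive.

Import GRing.Theory.
Import FinRing.Theory.
Local Open Scope ring_scope.

(** * Auxiliary facts on finite fields, roots of unity and residues *)

(** Cauchy's theorem in the additive group gives a nonzero [x] with [p x = 0], so [p] vanishes in
    [F]. This makes [x ^+ (q ^ n)] additive later on. *)
Lemma pnat_card_finField (F : finFieldType) : [pchar F].-nat #|F|.
Proof.
apply/pnatP; first by rewrite (cardD1 0).
move=> p p_pr p_dv; rewrite inE p_pr /=.
have [|x _ ox] := @Cauchy F p [set: F]%G p_pr; first by rewrite cardsT.
have : p%:R * (x : F) == 0.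
  by rewrite mulr_natl; have := expg_order x; rewrite ox zmodXgE => ->.
rewrite mulf_eq0 => /orP[] // /eqP x0.
by move: p_pr; rewrite -ox x0 order1.
Qed.

(** Cauchy's theorem in the multiplicative group. *)
Lemma finField_root_prime (F : finFieldType) (p : nat) :
  prime p -> (p %| #|F|.-1)%N -> exists2 t : F, t != 1 & t ^+ p = 1.
Proof.
rewrite -card_finField_unit => p_pr /(Cauchy p_pr)[t _ ot].
exists (val t); last by rewrite -val_unitX -ot expg_order.
apply: contraL p_pr => /eqP t1; rewrite -ot.
by rewrite (_ : t = 1%g) ?order1 //; apply: val_inj.
Qed.

Lemma sum_expr_unity_root (R : idomainType) (z : R) (d : nat) :
  z ^+ d = 1 -> z != 1 -> \sum_(k < d) z ^+ k = 0.
Proof.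
move=> zd z1; apply/eqP; move/eqP: (subrX1 z d).
by rewrite zd subrr eq_sym mulf_eq0 subr_eq0 (negPf z1).
Qed.

Lemma surj_injective (T : finType) (f : T -> T) :
  (forall y, exists x, f x = y) -> injective f.
Proof.
move=> surj.
have /image_injP inj : #|image f T| == #|T|.
  apply/eqP/eq_card => y; have [x <-] := surj y.
  by rewrite image_f.
by move=> x x'; apply: inj.
Qed.

Lemma coprime_prodP (I : finType) (m : I -> nat) (n : nat) :
  gcdn (\prod_i m i) n = 1%N <-> forall i, coprime (m i) n.
Proof.
split=> [/eqP co i | co]; last first.
  apply/eqP; rewrite -[_ == _]/(coprime _ _).
  by elim/big_rec: _ => [|i k _]; rewrite ?coprime1n // coprimeMl co.
by apply: coprime_dvdl co; rewrite (bigD1 i) //= dvdn_mulr.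
Qed.

(** * The maps [A_i] and the eigenspaces of Frobenius *)

Section Eigenspaces.

Variables (F K : finFieldType) (iota : {rmorphism F -> K}).
Variables (d : nat) (omega : F).
Hypothesis d_gt0 : (0 < d)%N.
Hypothesis omegaP : d.-primitive_root omega.
Hypothesis cardK : #|K| = (#|F| ^ d)%N.

Local Notation q := #|F|.
Local Notation w := (iota omega).
Local Notation A i x := (map_poly iota (Apoly d omega i)).[x].

Lemma iota_omega_prim : d.-primitive_root w.
Proof. by rewrite fmorph_primitive_root. Qed.

Lemma iota_omega_neq0 : w != 0.
Proof. by rewrite (prim_root_eq0 iota_omega_prim) -lt0n. Qed.

Lemma horner_Apoly i x :
  A i x = \sum_(k < d) w ^+ (i * k) * x ^+ (q ^ (d - 1 - k)).
Proof.
rewrite /Apoly rmorph_sum horner_sum; apply: eq_bigr => k _.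
by rewrite /= map_polyZ map_polyXn !hornerE rmorphXn.
Qed.

Lemma pnat_cardX n : [pchar K].-nat (q ^ n)%N.
Proof.
rewrite pnatX; apply/orP; left.
apply: sub_in_pnat (pnat_card_finField F) => p _.
exact: rmorph_pchar.
Qed.

Lemma iotaXq a : iota a ^+ q = iota a.
Proof. by rewrite -rmorphXn expf_card. Qed.

Lemma sum_Xq (I : Type) (r : seq I) (P : pred I) (G : I -> K) n :
  (\sum_(i <- r | P i) G i) ^+ (q ^ n) = \sum_(i <- r | P i) G i ^+ (q ^ n).
Proof.
apply: (big_morph (fun x => x ^+ (q ^ n))) => [x y|].
  exact/exprDn_pchar/pnat_cardX.
by rewrite expr0n expn_eq0 -[q]prednK ?andFb // (cardD1 0).
Qed.

Lemma Apoly_sum (I : Type) (r : seq I) (P : pred I) (G : I -> K) i :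
  A i (\sum_(j <- r | P j) G j) = \sum_(j <- r | P j) A i (G j).
Proof.
rewrite horner_Apoly (eq_bigr (fun k : 'I_d => \sum_(j <- r | P j)
   w ^+ (i * k) * G j ^+ (q ^ (d - 1 - k)))); last first.
  by move=> k _; rewrite sum_Xq mulr_sumr.
by rewrite exchange_big; apply: eq_bigr => j _; rewrite horner_Apoly.
Qed.

Lemma iotaXqn a n : iota a ^+ (q ^ n) = iota a.
Proof. by elim: n => [|n IH]; rewrite ?expr1 // expnSr exprM IH iotaXq. Qed.

Lemma ApolyZ a i x : A i (iota a * x) = iota a * A i x.
Proof.
rewrite !horner_Apoly mulr_sumr; apply: eq_bigr => k _.
by rewrite exprMn iotaXqn mulrCA.
Qed.

(** Frobenius shifts the terms of [A_i] cyclically, each shift costing a factor [w ^+ i]. *)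
Lemma Apoly_Xq i x : A i x ^+ q = w ^+ i * A i x.
Proof.
have [d' dE] : exists d', d = d'.+1 by exists d.-1; rewrite prednK.
have xqd : x ^+ (q ^ d) = x by rewrite -cardK expf_card.
have wd : w ^+ d = 1 by rewrite prim_expr_order // iota_omega_prim.
rewrite (_ : _ ^+ q = A i x ^+ (q ^ 1)); last by rewrite expn1.
rewrite horner_Apoly sum_Xq mulr_sumr.
(* The term [k = 0] on the left wraps around, by [x ^+ (q ^ d) = x] and [w ^+ d = 1], to the term
   [k = d - 1] on the right. *)
rewrite dE big_ord_recl big_ord_recr /= [RHS]addrC; congr (_ + _).
  rewrite muln0 mul1r -exprM -expnD subn1 subn0 addn1 -dE xqd.
  by rewrite mulrA -exprD dE subnn expr1 -mulnS -dE mulnC exprM wd expr1n mul1r.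
apply: eq_bigr => k _; rewrite expn1 exprMn -[in LHS]rmorphXn iotaXq rmorphXn.
rewrite -exprM -expnSr mulrA -exprD /bump add1n mulnS.
by congr (_ * _ ^+ (_ ^ _)); have := ltn_ord k; lia.
Qed.

Lemma natd_neq0 : d%:R != 0 :> K.
Proof. exact: prim_root_natf_neq0 iota_omega_prim. Qed.

(** After exchanging the sums, the coefficient of [x ^+ (q ^ (d - 1 - k))] is a geometric sum in
    [w ^+ k.+1], which vanishes unless [d] divides [k.+1], that is, [k = d - 1]. *)
Lemma sum_Apoly x : \sum_(i < d) w ^+ i * A i x = d%:R * x.
Proof.
have wd : w ^+ d = 1 by rewrite prim_expr_order // iota_omega_prim.
under eq_bigr => i _ do rewrite horner_Apoly mulr_sumr.
rewrite exchange_big /=.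
rewrite (eq_bigr (fun k : 'I_d =>
   (\sum_(i < d) (w ^+ k.+1) ^+ i) * x ^+ (q ^ (d - 1 - k)))); last first.
  move=> k _; rewrite mulr_suml; apply: eq_bigr => i _.
  by rewrite mulrA -exprD -mulnS -exprM mulnC.
have dd : (d.-1 < d)%N by rewrite prednK.
rewrite (bigD1 (Ordinal dd)) //= [X in _ + X]big1 ?addr0.
  rewrite prednK // wd subn1 subnn expr1.
  under eq_bigr => i _ do rewrite expr1n.
  by rewrite sumr_const card_ord.
move=> k; rewrite -val_eqE /= => kd.
rewrite sum_expr_unity_root ?mul0r //.
  by rewrite -exprM mulnC exprM wd expr1n.
rewrite -(prim_order_dvd iota_omega_prim) gtnNdvd //.
by have := ltn_ord k; lia.
Qed.

Lemma eigen_Xq_iter j v n :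
  v ^+ q = w ^+ j * v -> v ^+ (q ^ n) = w ^+ (j * n) * v.
Proof.
move=> vE; elim: n => [|n IH]; first by rewrite muln0 expr1 mul1r.
rewrite expnSr exprM IH exprMn vE -rmorphXn iotaXq rmorphXn mulrA -exprD.
by rewrite mulnS addnC.
Qed.

(** Iterated Frobenius acts on [v] by powers of [w ^+ j], so [A_i] becomes a geometric sum in
    [w ^+ i / w ^+ j]. *)
Lemma Apoly_eigen i j v : v ^+ q = w ^+ j * v ->
  A i v = if i == j %[mod d] then d%:R * w ^- i * v else 0.
Proof.
move=> vE; have wd : w ^+ d = 1 by rewrite prim_expr_order // iota_omega_prim.
rewrite horner_Apoly (eq_bigr (fun k : 'I_d =>
   (w ^+ i / w ^+ j) ^+ k * (w ^- j * v))); last first.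
  move=> k _; rewrite (eigen_Xq_iter _ vE) !mulrA; congr (_ * v).
  (* The exponents on the two sides differ by [d * j], and [w ^+ d = 1]. *)
  have -> : w ^+ (j * (d - 1 - k)) = w ^- j * w ^- (j * k).
    have e : (j * (d - 1 - k) + (j + j * k) = d * j)%N.
      rewrite -mulnS -mulnDr mulnC; congr (_ * _)%N.
      by have := ltn_ord k; lia.
    apply: (mulIf (expf_neq0 (j + j * k) iota_omega_neq0)); rewrite -exprD e.
    rewrite -invfM -exprD mulVf ?expf_neq0 ?iota_omega_neq0 //.
    by rewrite exprM wd expr1n.
  by rewrite expr_div_n -!exprM mulrCA -mulrA mulrC !mulrA.
rewrite -mulr_suml -(eq_prim_root_expr iota_omega_prim).
case: eqP => [<- | /eqP ij].
  rewrite divff ?expf_neq0 ?iota_omega_neq0 //.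
  under eq_bigr => k _ do rewrite expr1n.
  by rewrite sumr_const card_ord mulrA.
rewrite sum_expr_unity_root ?mul0r //.
  by rewrite expr_div_n -!exprM ![(_ * d)%N]mulnC !exprM wd !expr1n divr1.
by apply: contra ij => /eqP /divr1_eq ->.
Qed.

Lemma ApolyX_Xq i x n : (A i x ^+ n) ^+ q = w ^+ (i * n) * A i x ^+ n.
Proof. by rewrite exprAC Apoly_Xq exprMn -exprM. Qed.

Lemma Apoly_inj x y : (forall i : 'I_d, A i x = A i y) -> x = y.
Proof.
move=> xy; apply: (mulfI natd_neq0); rewrite -!sum_Apoly.
by apply: eq_bigr => i _; rewrite xy.
Qed.

(** * Nonzero eigenvectors and power maps on an eigenspace *)

(** A nonzero polynomial of degree at most [q ^ d.-1] cannot vanish at all [q ^ d] points of [K]. *)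
Lemma Apoly_ex_neq0 i : exists x, A i x != 0.
Proof.
have q_gt1 : (1 < q)%N by apply: finNzRing_gt1.
apply/existsP; apply: contraT; rewrite negb_exists => /forallP A0.
have sz : (size (map_poly iota (Apoly d omega i)) <= (q ^ d.-1).+1)%N.
  rewrite size_map_poly; apply: leq_trans (size_sum _ _ _) _.
  apply/bigmax_leqP => k _; apply: leq_trans (size_scale_leq _ _) _.
  by rewrite size_polyXn ltnS leq_exp2l //; lia.
have nz : map_poly iota (Apoly d omega i) != 0.
  rewrite map_poly_eq0; apply/eqP.
  (* Only [k = 0] contributes to this coefficient, which is therefore 1. *)
  move=> /(congr1 (fun p : {poly F} => p`_(q ^ d.-1))).
  rewrite coef0 coef_sum (bigD1 (Ordinal d_gt0)) //= big1 => [/eqP|k].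
    by rewrite coefZ coefXn muln0 subn0 subn1 eqxx mulr1 addr0 oner_eq0.
  rewrite -val_eqE /= => k0; rewrite coefZ coefXn eqn_exp2l //.
  by rewrite (_ : (_ == _) = false) ?mulr0 //; have := ltn_ord k; lia.
have rt : all (root (map_poly iota (Apoly d omega i))) (enum K).
  by apply/allP => x _; rewrite rootE; have := A0 x; rewrite negbK.
have := leq_trans (max_poly_roots nz rt (enum_uniq K)) sz.
by rewrite -cardT cardK ltnS leq_exp2l // leqNgt prednK ?leqnn.
Qed.

Lemma eigen_ex_neq0 i : exists2 v : K, v != 0 & v ^+ q = w ^+ i * v.
Proof.
by have [x x0] := Apoly_ex_neq0 i; exists (A i x) => //; apply: Apoly_Xq.
Qed.

Lemma eigen_ratio i v v' : v ^+ q = w ^+ i * v -> v' ^+ q = w ^+ i * v' ->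
  v' != 0 -> (v / v') ^+ q = v / v'.
Proof.
move=> vE v'E v0; rewrite expr_div_n vE v'E -mulf_div divff ?mul1r //.
by rewrite expf_neq0 // iota_omega_neq0.
Qed.

(** The ratio [t] of two nonzero eigenvectors is fixed by Frobenius, so [t ^+ (q - 1) = 1]. Together
    with [t ^+ m = 1], a Bezout relation forces [t = 1]. *)
Lemma eigen_expr_inj i m v v' : (0 < m)%N -> coprime m (q - 1) ->
  v ^+ q = w ^+ i * v -> v' ^+ q = w ^+ i * v' -> v ^+ m = v' ^+ m -> v = v'.
Proof.
move=> m_gt0 co vE v'E vm.
have [v'0|v'0] := eqVneq v' 0.
  by move/eqP: vm; rewrite v'0 expr0n gtn_eqF // expf_eq0 m_gt0 => /eqP.
have v0 : v != 0.
  apply: contraNneq v'0 => v0; move/eqP: vm.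
  by rewrite v0 expr0n gtn_eqF // eq_sym expf_eq0 m_gt0.
apply: (divIf v'0); rewrite divff //.
have q_gt1 : (1 < q)%N by apply: finNzRing_gt1.
set t := v / v'.
have tn0 : t != 0 by rewrite mulf_neq0 ?invr_eq0.
have tm : t ^+ m = 1 by rewrite expr_div_n vm divff // expf_neq0.
have tq : t ^+ (q - 1) = 1.
  apply: (mulIf tn0); rewrite -exprSr mul1r subn1 prednK ?(ltnW q_gt1) //.
  exact: eigen_ratio vE v'E v'0.
have [km kq e _] := egcdnP (q - 1) m_gt0.
have : t ^+ (km * m) = t.
  by rewrite e (eqP co) addn1 exprSr mulnC exprM tq expr1n mul1r.
by rewrite mulnC exprM tm expr1n.
Qed.

(** For [v != 0], [v ^+ (q - 1)] equals [w ^+ i], whose [d]-th power is 1. *)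
Lemma eigen_expr_mod i v n : v ^+ q = w ^+ i * v -> (0 < n)%N ->
  n = 1 %[mod d * (q - 1)] -> v ^+ n = v.
Proof.
move=> vE n_gt0 n1; have [->|v0] := eqVneq v 0; first by rewrite expr0n gtn_eqF.
have q_gt1 : (1 < q)%N by apply: finNzRing_gt1.
have vd : v ^+ (d * (q - 1)) = 1.
  have vq : v ^+ (q - 1) = w ^+ i.
    by apply: (mulIf v0); rewrite -vE -exprSr subn1 prednK ?(ltnW q_gt1).
  rewrite mulnC exprM vq -exprM mulnC exprM.
  by rewrite (prim_expr_order iota_omega_prim) expr1n.
by rewrite -(expr_mod n vd) n1 expr_mod.
Qed.

(** * The polynomial [f] in the coordinates [A_i] *)

Section Polynomial.

Variables (m : 'I_d -> nat) (u : 'I_d -> F).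
Hypothesis m_gt0 : forall i, (0 < m i)%N.

Local Notation f x := (map_poly iota (fpoly omega m u)).[x].

Lemma horner_fpoly x : f x = \sum_(i < d) iota (u i) * A i x ^+ m i.
Proof.
rewrite /fpoly rmorph_sum horner_sum; apply: eq_bigr => i _.
by rewrite /= map_polyZ rmorphXn /= hornerZ horner_exp.
Qed.

(** The power [A i x ^+ m i] is an eigenvector for [w ^+ (i * m i)], so [A_c] keeps only the
    summands with [i * m i] congruent to [c]. *)
Lemma Apoly_fpoly c x : A c (f x) =
  \sum_(i < d | c == i * m i %[mod d])
     iota (u i) * (d%:R * w ^- c * A i x ^+ m i).
Proof.
rewrite horner_fpoly Apoly_sum [RHS]big_mkcond; apply: eq_bigr => i _ /=.
rewrite ApolyZ (Apoly_eigen _ (ApolyX_Xq i x (m i))).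
by case: ifP; rewrite ?mulr0.
Qed.

Definition residue (i : 'I_d) : 'I_d := Ordinal (ltn_pmod (i * m i) d_gt0).

Lemma eq_residue (c i : 'I_d) : (c == i * m i %[mod d]) = (c == residue i).
Proof. by rewrite modn_small // -val_eqE. Qed.

Lemma Apoly_residue_fpoly i x : injective residue ->
  A (residue i) (f x) = iota (u i) * (d%:R * w ^- residue i * A i x ^+ m i).
Proof.
move=> inj; rewrite Apoly_fpoly (big_pred1 i) // => k.
by rewrite eq_residue inj_eq // eq_sym.
Qed.

(** Hitting every class makes [residue] surjective on ['I_d], hence injective. Conversely its
    inverse provides the representative of each class. *)
Lemma complete_residue_injP :
  complete_residue_system d (codom (fun i : 'I_d => (i * m i)%N)) <->
  injective residue.
Proof.
split=> [crs | inj c].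
  apply: surj_injective => c; have [s [[/codomP[i ->] sc] _]] := crs c.
  by exists i; apply: val_inj; rewrite /= sc modn_small.
have [h rh hr] := injF_bij inj.
pose i := h (Ordinal (ltn_pmod c d_gt0)).
have iE : i * m i = c %[mod d].
  by have /(congr1 val) := hr (Ordinal (ltn_pmod c d_gt0)).
exists (i * m i)%N; split; first by split=> //; apply: codom_f.
move=> s [/codomP[k ->] kc].
by have -> : i = k by apply: inj; apply: val_inj; rewrite /= iE kc.
Qed.

(** Component [residue i] of [f x] determines [A i x ^+ m i], hence [A i x], and these coordinates
    determine [x]. *)
Lemma fpoly_inj : injective residue -> (forall i, u i != 0) ->
  (forall i, coprime (m i) (q - 1)) -> injective (fun x : K => f x).
Proof.
move=> inj u0 co x y fxy; apply: Apoly_inj => i.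
apply: (eigen_expr_inj (m_gt0 i) (co i)); try exact: Apoly_Xq.
have c0 : iota (u i) != 0 by rewrite fmorph_eq0.
have b0 : d%:R * w ^- residue i != 0.
  by rewrite mulf_neq0 ?natd_neq0 // invr_eq0 expf_neq0 // iota_omega_neq0.
have : A (residue i) (f x) = A (residue i) (f y) by rewrite fxy.
by rewrite !Apoly_residue_fpoly // => /(mulfI c0)/(mulfI b0).
Qed.

(** * Necessity of the three conditions *)

(** If [residue] missed [c], then [A_c] would vanish on the image of [f], which is all of [K]. *)
Lemma fpoly_bij_residue : bijective (fun x : K => f x) -> injective residue.
Proof.
move=> [g fg gf].
apply: surj_injective => c; have [y y0] := Apoly_ex_neq0 c.
apply/exists_eqP; apply: contraNT y0; rewrite negb_exists => /forallP rc.
rewrite -(gf y) Apoly_fpoly big_pred0 // => i.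
by rewrite eq_residue eq_sym; apply: negPf.
Qed.

Lemma fpoly_eigen (i : 'I_d) v : v ^+ q = w ^+ i * v ->
  f v = iota (u i) * (d%:R * w ^- i * v) ^+ m i.
Proof.
move=> vE; rewrite horner_fpoly (bigD1 i) //= big1 ?addr0.
  by rewrite (Apoly_eigen _ vE) eqxx.
move=> k ki; rewrite (Apoly_eigen _ vE) !modn_small // val_eqE (negPf ki).
by rewrite expr0n gtn_eqF // mulr0.
Qed.

(** If [u i = 0], then [f] sends a nonzero eigenvector for [w ^+ i] to 0, as it does 0 itself. *)
Lemma fpoly_inj_coef i : injective (fun x : K => f x) -> u i != 0.
Proof.
move=> inj; apply/eqP => u0; have [v v0 vE] := eigen_ex_neq0 i.
have q_gt0 : (0 < q)%N by rewrite (cardD1 0).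
case/eqP: v0; apply: inj; rewrite /= (fpoly_eigen vE) u0 rmorph0 mul0r.
have /fpoly_eigen-> : 0 ^+ q = w ^+ i * 0 by rewrite mulr0 expr0n gtn_eqF.
by rewrite u0 rmorph0 mul0r.
Qed.

(** A common prime [p] of [m i] and [q - 1] yields [t != 1] in [F] with [t ^+ p = 1]. Then [f] takes
    the same value at [v] and [iota t * v] for an eigenvector [v]. *)
Lemma fpoly_inj_coprime i :
  injective (fun x : K => f x) -> coprime (m i) (q - 1).
Proof.
move=> inj; apply: contraT; rewrite /coprime => g1.
have g0 : (0 < gcdn (m i) (q - 1))%N by rewrite gcdn_gt0 m_gt0.
have [|p p_pr] := @pdivP (gcdn (m i) (q - 1)); first by lia.
rewrite dvdn_gcd subn1 => /andP[pm /(finField_root_prime p_pr)[t /eqP t1 tp]].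
have [v v0 vE] := eigen_ex_neq0 i.
case: t1; apply: (fmorph_inj iota); apply: (mulIf v0); apply: inj.
rewrite rmorph1 mul1r /= (fpoly_eigen vE) (@fpoly_eigen i); last first.
  by rewrite exprMn iotaXq vE mulrCA.
have tm : t ^+ m i = 1 by rewrite -(divnK pm) mulnC exprM tp expr1n.
by congr (_ * _); rewrite mulrCA exprMn -[iota t ^+ _]rmorphXn tm rmorph1 mul1r.
Qed.

(** * The compositional inverse and the final assembly *)

Lemma finvpoly_cancel (r : 'I_d -> nat) (j : 'I_d -> 'I_d) :
  (forall i, (0 < r i)%N) ->
  (forall i, (m i * r i)%N = 1 %[mod d * (q - 1)]) ->
  (forall i, j i = (i * m i)%N %[mod d]) ->
  injective residue -> (forall i, u i != 0) ->
  cancel (fun x : K => f x)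
    (fun y : K => (map_poly iota (finvpoly omega r u j)).[y]).
Proof.
move=> r_gt0 mr jE inj u0 x.
have {jE} jE i : j i = residue i.
  by apply/eqP; rewrite -eq_residue jE.
(* After multiplication by [d], the formula is compared termwise with the expansion of [d x] in the
   [A i x]. *)
apply: (mulfI natd_neq0); rewrite -(sum_Apoly x) /finvpoly map_polyZ hornerZ.
rewrite fmorphV rmorph_nat mulrA divff ?natd_neq0 // mul1r.
rewrite rmorph_sum horner_sum; apply: eq_bigr => i _ /=.
rewrite map_polyZ hornerZ rmorphXn horner_exp /= jE Apoly_residue_fpoly //.
rewrite rmorphM rmorphXn -mulrA; congr (_ * _).
rewrite fmorphV rmorphXn !rmorphM fmorphV rmorphXn rmorph_nat.
(* The scalar coming from [f], raised to [r i], cancels the coefficient of the inverse and leaves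
   [A i x ^+ (m i * r i)], which is [A i x]. *)
rewrite mulrA [iota _ * _]mulrA [iota _ * _]mulrC [X in _ * X]exprMn mulKf.
  rewrite -exprM (eigen_expr_mod (Apoly_Xq i x)) //.
  by rewrite muln_gt0 m_gt0 r_gt0.
rewrite expf_neq0 // !mulf_neq0 ?natd_neq0 ?fmorph_eq0 //.
by rewrite invr_eq0 expf_neq0 // iota_omega_neq0.
Qed.

End Polynomial.

End Eigenspaces.

Theorem theorem6p1
  (d q : nat) (F K : finFieldType) (iota : {rmorphism F -> K}) (omega : F)
  (m : 'I_d -> nat) (u : 'I_d -> F)
  (d_gt1 : (1 < d)%N)
  (cardF : #|F| = q)
  (cardK : #|K| = (q ^ d)%N)
  (q_mod : q = 1 %[mod d])
  (omegaP : d.-primitive_root omega)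
  (m_gt0 : forall i : 'I_d, (0 < m i)%N) :
  let f := fpoly omega m u in
  (permutation_poly (map_poly iota f) <->
     [/\ complete_residue_system d (codom (fun i : 'I_d => (i * m i)%N)),
         \prod_(i < d) u i != 0
       & gcdn (\prod_(i < d) m i) (q - 1) = 1%N]) /\
  (permutation_poly (map_poly iota f) ->
     forall r : 'I_d -> nat,
       (forall i : 'I_d, (0 < r i)%N) ->
       (forall i : 'I_d, (m i * r i)%N = 1 %[mod d * (q - 1)]) ->
     forall j : 'I_d -> 'I_d,
       (forall i : 'I_d, j i = (i * m i)%N %[mod d]) ->
     compositional_inverse (map_poly iota f)
       (map_poly iota (finvpoly omega r u j))).
Proof.
move=> f; subst q; have d_gt0 := ltnW d_gt1.
split; first split.
- move=> bij; have inj := bij_inj bij; split.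
  + exact/(complete_residue_injP d_gt0)/(fpoly_bij_residue omegaP cardK bij).
  + apply/prodf_neq0 => i _.
    exact: (fpoly_inj_coef d_gt0 omegaP cardK m_gt0 _ inj).
  + apply/coprime_prodP => i.
    exact: (fpoly_inj_coprime d_gt0 omegaP cardK m_gt0 _ inj).
- case=> /(complete_residue_injP d_gt0) inj /prodf_neq0 u0 /coprime_prodP co.
  apply: injF_bij; apply: (fpoly_inj omegaP cardK m_gt0 inj) => // i.
  exact: u0.
move=> bij r r_gt0 mr j jE; have inj := bij_inj bij.
have u0 i : u i != 0.
  exact: (fpoly_inj_coef d_gt0 omegaP cardK m_gt0 _ inj).
have rinj := @fpoly_bij_residue _ _ _ _ _ d_gt0 omegaP cardK _ _ bij.
have fK := finvpoly_cancel iota omegaP cardK m_gt0 r_gt0 mr jE rinj u0.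
(* The other cancellation follows by writing [y] as [f] of [g y], since [f] is surjective. *)
by split=> // y; have [g _ gK] := bij; rewrite -[y in RHS]gK -[y]gK fK.
Qed.
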